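(* There exists a locally trivial holomorphic fiber bundle $\rho:Y\to B$ (with $Y$ and $B$ complex manifolds) with fiber isomorphic to the unit disc $\Delta=\{z\in\mathbb{C}:|z|<1\}$ such that $d_Y\equiv 0$, where $d_Y$ denotes the Kobayashi pseudodistance of $Y$.
   Context: Locally trivial holomorphic fiber bundle means that the local trivializations are biholomorphic: every point of $B$ has an open neighbourhood $U$ with a biholomorphic map $\rho^{-1}(U)\cong U\times\Delta$ compatible with the projections to $U$. Let $d_\Delta$ be the Poincaré distance on $\Delta$. For a complex manifold $Y$ and $p,q\in Y$, the Kobayashi pseudodistance $d_Y(p,q)$ is the infimum of $\sum_{i=1}^k d_\Delta(a_i,b_i)$ over all chains of discs from $p$ to $q$, i.e. over all $k\ge 1$, points $p=p_0,p_1,\dots,p_k=q$ of $Y$, points $a_i,b_i\in\Delta$ and holomorphic maps $f_i:\Delta\to Y$ with $f_i(a_i)=p_{i-1}$ and $f_i(b_i)=p_i$. The notation $d_Y\equiv 0$ means $d_Y(p,q)=0$ for all $p,q\in Y$. *)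

(* Defs.v *)
From HB Require Import structures.
From mathcomp Require Import all_boot all_order all_algebra.
From mathcomp Require Import all_classical all_reals all_analysis.
From mathcomp Require Import complex.

Set Implicit Arguments.
Unset Strict Implicit.
Unset Printing Implicit Defensive.

Import Order.TTheory GRing.Theory Num.Theory numFieldNormedType.Exports.
Local Open Scope classical_set_scope.
Local Open Scope ring_scope.

(** The complex numbers are [R[i]] for an arbitrary [R : realType].  Since
    [differentiable] is taken between normed modules over [R[i]], its
    differential is C-linear: it is complex differentiability.  The alias
    [R[i]^o] is needed where the topology of [R[i]] has to be inferred. *)

Section ComplexManifolds.
Variable R : realType.

(** Names the normed module structure, from which the topology of C^n is
    inferred. *)
Definition Cn (n : nat) : normedModType R[i] := 'rV[R[i]]_n.

(** Only the values of [chart_fun] on [chart_dom] and those of [chart_inv] on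
    the image of [chart_dom] are meaningful. *)
Record chart (M : topologicalType) (n : nat) := Chart {
  chart_dom : set M;
  chart_fun : M -> Cn n;
  chart_inv : Cn n -> M
}.

Definition chart_codom (M : topologicalType) (n : nat) (phi : chart M n) :
    set (Cn n) :=
  chart_fun phi @` chart_dom phi.

Definition is_chart (M : topologicalType) (n : nat) (phi : chart M n) : Prop :=
  [/\ open (chart_dom phi),
      open (chart_codom phi),
      (forall p, chart_dom phi p -> chart_inv phi (chart_fun phi p) = p),
      (forall p, chart_dom phi p -> {for p, continuous (chart_fun phi)}) &
      (forall v, chart_codom phi v -> {for v, continuous (chart_inv phi)})].

Definition chart_compatible (M : topologicalType) (n : nat)
    (phi psi : chart M n) : Prop :=
  forall p, chart_dom phi p -> chart_dom psi p ->
    differentiable (chart_fun psi \o chart_inv phi) (chart_fun phi p).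

Record chartedSpace := ChartedSpace {
  carrier :> topologicalType;
  mdim : nat;
  atlas : set (chart carrier mdim)
}.
Arguments atlas : clear implicits.

Definition complex_manifold (M : chartedSpace) : Prop :=
  [/\ hausdorff_space M,
      @second_countable M,
      (forall phi, atlas M phi -> is_chart phi),
      (forall p : M, exists2 phi, atlas M phi & chart_dom phi p) &
      (forall phi psi, atlas M phi -> atlas M psi -> chart_compatible phi psi)].

Definition prod_chart (M N : topologicalType) (m n : nat)
    (phi : chart M m) (psi : chart N n) : chart (M * N)%type (m + n) :=
  Chart (chart_dom phi `*` chart_dom psi)
    (fun p => row_mx (chart_fun phi p.1) (chart_fun psi p.2) : Cn (m + n))
    (fun v => (chart_inv phi (lsubmx v), chart_inv psi (rsubmx v))).

Definition prod_space (M N : chartedSpace) : chartedSpace :=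
  @ChartedSpace (M * N)%type (mdim M + mdim N)
    [set chi | exists phi psi,
       [/\ atlas M phi, atlas N psi & chi = prod_chart phi psi]].

Definition complex_line : chartedSpace :=
  @ChartedSpace R[i]^o 1
    [set Chart [set: R[i]^o] (fun z => \row_(_ < 1) z : Cn 1) (fun v => v 0 0)].

(** [U] is meant to be an open subset of [M], and [f] is only constrained on
    [U]: this is holomorphy of a map from the open submanifold [U] to [N]. *)
Definition holomorphic_on (M N : chartedSpace) (U : set M) (f : M -> N) : Prop :=
  forall p, U p ->
    {for p, continuous f} /\
    forall phi psi, atlas M phi -> atlas N psi ->
      chart_dom phi p -> chart_dom psi (f p) ->
      differentiable (chart_fun psi \o f \o chart_inv phi) (chart_fun phi p).

(** [f] restricts to a biholomorphic map between the open submanifolds [U] of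
    [M] and [V] of [N]. *)
Definition biholomorphic_on (M N : chartedSpace) (U : set M) (V : set N)
    (f : M -> N) : Prop :=
  exists g : N -> M,
    [/\ holomorphic_on U f, holomorphic_on V g,
        (forall p, U p -> V (f p) /\ g (f p) = p) &
        (forall q, V q -> U (g q) /\ f (g q) = q)].

Definition disc : set complex_line := [set z : R[i] | `|z| < 1].

Definition disc_bundle (Y B : chartedSpace) (rho : Y -> B) : Prop :=
  holomorphic_on [set: Y] rho /\
  forall b : B, exists U : set B,
    [/\ open U, U b &
        exists f : Y -> prod_space B complex_line,
          @biholomorphic_on Y (prod_space B complex_line)
            (rho @^-1` U) (U `*` disc) f /\
          forall y, U (rho y) -> (f y).1 = rho y].

(** The distance of the metric [2 |dz| / (1 - |z|^2)], of curvature -1. *)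
Definition poincare_dist (a b : R[i]) : R :=
  let t := complex.Re `| (a - b) / (1 - a^* * b) | in
  ln ((1 + t) / (1 - t)).

Definition chain_of_discs (Y : chartedSpace) (p q : Y) (k : nat)
    (pt : nat -> Y) (a b : nat -> R[i]) (f : nat -> complex_line -> Y) : Prop :=
  [/\ (0 < k)%N, pt 0%N = p, pt k = q &
      forall i : nat, (i < k)%N ->
        [/\ disc (a i), disc (b i), holomorphic_on disc (f i),
            f i (a i) = pt i & f i (b i) = pt i.+1]].

(** The infimum is [+oo] when no chain of discs joins [p] to [q]. *)
Definition kobayashi (Y : chartedSpace) (p q : Y) : \bar R :=
  ereal_inf [set d : \bar R | exists k pt a b f,
    chain_of_discs p q k pt a b f /\
    d = (\sum_(i < k) poincare_dist (a i) (b i))%:E].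

End ComplexManifolds.

Arguments atlas {R} c _.

(* Main.v *)
(** Write H for the upper half-plane.  A disc bundle with holomorphic
    trivializations is flat, so [d_Y] vanishes once the universal cover of the
    base has vanishing pseudodistance and the holonomy has dense orbits on H.
    Take for base the tube [R^2 + i W] over the plane region
    [W = { (y1, y2) | y2 <> 0 or y1 in G }], where G is a union of four open
    intervals: two half-planes joined through four gaps.  A family of affine
    automorphisms [u |-> a(y1) u + b(y1)] of H, continuous in y1 and constant on
    each component of G, is used to twist the fibre coordinate over [y2 < 0];
    travelling down through one gap and back up through the first one then acts
    on the fibre by the value taken on that gap.  The four values are
    [u], [e u], [e^(sqrt 2) u] and [u + 1].  The base contains enough complex
    lines with real direction for all of this to cost no Kobayashi length, and
    since [1] and [sqrt 2] generate a dense subgroup of R, every [e^s u], and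
    then every [u + t = e^s (e^(-s) u + 1)] with [e^s = t > 0], is at distance 0
    from [u]. *)

From HB Require Import structures.
Require Import Defs.
From mathcomp Require Import all_boot all_order all_algebra.
From mathcomp Require Import all_classical all_reals all_analysis.
From mathcomp Require Import complex ring lra.

Set Implicit Arguments.
Unset Strict Implicit.
Unset Printing Implicit Defensive.

Import Order.TTheory GRing.Theory Num.Theory numFieldNormedType.Exports.
Local Open Scope classical_set_scope.
Local Open Scope ring_scope.

Local Notation Re := (@complex.Re _).
Local Notation Im := (@complex.Im _).

(** * Maps into a product with a line *)

Section Differentiability.
Variable K : numFieldType.

(** Inverse charts are total functions with arbitrary values off their codomain, so the maps to be
    differentiated agree with their intended formulas only near a point. *)
Lemma near_eq_differentiable (V W : normedModType K) (f g : V -> W) x :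
  (\forall y \near x, f y = g y) -> differentiable f x -> differentiable g x.
Proof.
move=> fg df.
have fgx : f x = g x := nbhs_singleton fg.
have H : g \o shift x = cst (g x) + 'd f x +o_ 0 id.
  apply/eqaddoP => _/posnumP[e]; near=> h.
  have -> : (g \o shift x - (cst (g x) + 'd f x)) h =
     (f \o shift x - (cst (f x) + 'd f x)) h.
    rewrite !fctE /= fgx; congr (_ - _); apply/esym.
    near: h; move: fg; rewrite (near_shift 0 x) subr0; exact.
  by near: h; move: (diff_locally df) => /eqaddoP; apply.
(* By uniqueness of the differential, the expansion [H] identifies ['d g x] with the continuous map
   ['d f x]. *)
apply/diff_locallyP.
have -> // := diff_unique (@diff_continuous _ _ _ _ _ df) H.
split => //; exact: diff_continuous.
Unshelve. all: by end_near. Qed.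

(** This has the exact shape of the product charts with [complex_line], so a trivialization read in
    charts is literally a [join]. *)
Definition join {n} (x : 'rV[K]_n) (w : K) : 'rV[K]_(n + 1) :=
  row_mx x (\row_(_ < 1) w).

Definition last_coord {n} (v : 'rV[K]_(n + 1)) : K := rsubmx v 0 0.

Lemma lsubmx_join n (x : 'rV[K]_n) w : lsubmx (join x w) = x.
Proof. by rewrite /join row_mxKl. Qed.

Lemma last_coord_join n (x : 'rV[K]_n) w : last_coord (join x w) = w.
Proof. by rewrite /last_coord row_mxKr mxE. Qed.

Lemma join_lsubmx n (v : 'rV[K]_(n + 1)) : join (lsubmx v) (last_coord v) = v.
Proof.
rewrite -[RHS]hsubmxK /join; congr row_mx.
by apply/rowP => i; rewrite mxE ord1.
Qed.

Lemma mx_continuous_at (T : topologicalType) m n (f : T -> 'M[K]_(m, n)) x :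
  (forall i j, {for x, continuous (fun t => f t i j : K^o)}) ->
  {for x, continuous f}.
Proof.
move=> fc A [P Pf PA].
have : \forall t \near x, forall i j, P i j (f t i j).
  apply: filter_forall => i; apply: filter_forall => j.
  exact: (fc i j _ (Pf i j)).
by apply: filterS => t Pt; exact: PA.
Qed.

Lemma join_continuous_at (T : topologicalType) n (f : T -> 'rV[K]_n)
    (g : T -> K^o) x :
  {for x, continuous f} -> {for x, continuous g} ->
  {for x, continuous (fun t => join (f t) (g t))}.
Proof.
move=> fc gc; apply: mx_continuous_at => i j; rewrite ord1.
case: (split_ordP j) => k ->.
  rewrite (_ : (fun t => _) = fun t => f t 0 k); last first.
    by apply/funext => t; rewrite /join row_mxEl.
  by apply: (@continuous_comp _ _ _ f (fun M : 'rV[K]_n => M 0 k));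
    [exact: fc|exact: coord_continuous].
rewrite (_ : (fun t => _) = g) //.
by apply/funext => t; rewrite /join row_mxEr mxE.
Qed.

Lemma last_coord_continuous n : continuous (last_coord : 'rV[K]_(n + 1) -> K^o).
Proof.
move=> v; rewrite /last_coord.
exact: (continuous_comp (@continuous_rsubmx _ _ _ _ v)
  (@coord_continuous K 1 1 0 0 (rsubmx v))).
Qed.

(** Since [join x w = join x 0 + w *: join 0 1], the map is a continuous linear image of [f] plus
    [g] times a fixed vector. *)
Lemma differentiable_join (V : normedModType K) n (f : V -> 'rV[K]_n)
    (g : V -> K^o) x :
  differentiable f x -> differentiable g x ->
  differentiable (fun t => join (f t) (g t)) x.
Proof.
move=> df dg.
have lin : linear (fun y : 'rV[K]_n => join y 0).
  move=> a u v; apply/rowP => j; rewrite /join !mxE.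
  by case: (fintype.split j) => k; rewrite !mxE // mulr0 addr0.
pose linM := GRing.isLinear.Build _ _ _ _ _ lin.
pose linL : {linear _ -> _} := HB.pack (fun y : 'rV[K]_n => join y 0) linM.
have dl y : differentiable (fun y : 'rV[K]_n => join y 0) y.
  apply: (@linear_differentiable _ _ _ linL) => z.
  by apply: join_continuous_at; [exact: cvg_id|exact: (@cst_continuous _ K^o 0)].
rewrite (_ : (fun t => _) = (fun t => join (f t) 0) + (fun t => g t *: join 0 1)).
  apply: differentiableD; last exact: differentiableZl.
  exact: (differentiable_comp df (dl _)).
apply/funext => t; apply/rowP => j; rewrite fctE /join !mxE.
by case: (fintype.split j) => k; rewrite !mxE ?mulr0 ?addr0 // mulr1 add0r.
Qed.

Lemma differentiable_last_coord n (v : 'rV[K]_(n + 1)) :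
  differentiable (last_coord : 'rV[K]_(n + 1) -> K^o) v.
Proof.
exact: (differentiable_comp (differentiable_rsubmx v)
  (@differentiable_coord K 1 1 (rsubmx v) 0 0)).
Qed.

End Differentiability.

(** * Subsets of a topological space as spaces *)

Section OpenSubsets.
Variables (T : topologicalType) (E : set T).

Lemma set_type_continuous_at (X : topologicalType) (f : X -> E) x :
  {for x, continuous (fun t => val (f t))} -> {for x, continuous f}.
Proof.
move=> cf U [_ [[W oW <-] /= Wx WU]].
apply: (@filterS _ _ _ ((fun t => val (f t)) @^-1` W)).
  by move=> t; exact: WU.
by apply: cf; exact: open_nbhs_nbhs.
Qed.

Lemma val_continuous : continuous (val : E -> T).
Proof. exact: initial_continuous. Qed.

Lemma set_type_hausdorff : hausdorff_space T -> hausdorff_space E.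
Proof.
move=> hT p q pq; apply: val_inj; apply: hT => A B nA nB.
have [z [Az Bz]] := pq _ _ (val_continuous nA) (val_continuous nB).
by exists (val z).
Qed.

Lemma set_type_second_countable : @second_countable T -> @second_countable E.
Proof.
move=> [B cB [oB bB]]; exists [set val @^-1` U | U in B].
  exact: (card_le_trans (card_image_le _ _)).
split; first by move=> _ [U BU <-]; exists U => //; exact: oB.
move=> x A [_ [[W oW <-] Wx WA]].
have [U [BU Ux] UW] : filter_from [set U | B U /\ U (val x)] id W.
  by apply: bB; exact: open_nbhs_nbhs.
exists (val @^-1` U); first by split => //; exists U.
by move=> t Ut; apply: WA; exact: UW.
Qed.

Variable p0 : E.

(** The default [p0] makes the inverse of [val] total, as the field [chart_inv] requires; on an open
    [E] it is never seen near a point of [E]. *)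
Definition to_sub (v : T) : E := insubd p0 v.

Lemma val_to_sub v : E v -> val (to_sub v) = v.
Proof. by move=> Ev; rewrite /to_sub insubdK //; exact: mem_set. Qed.

Lemma to_sub_val (p : E) : to_sub (val p) = p.
Proof. exact: valKd. Qed.

Lemma set_typeP (p : E) : E (val p).
Proof. by apply: set_mem; exact: valP. Qed.

Lemma to_sub_continuous_at v : open E -> E v -> {for v, continuous to_sub}.
Proof.
move=> oE Ev; apply: set_type_continuous_at.
rewrite /prop_for /continuous_at val_to_sub // => A nA.
have nE : nbhs v E by exact: open_nbhs_nbhs.
suff : \forall t \near v, A (val (to_sub t)) by [].
by apply: filterS2 nA nE => t At Et; rewrite val_to_sub.
Qed.

End OpenSubsets.

(** * Complex numbers over a real type *)

Section ComplexNumbers.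
Variable R : realType.
Local Notation C := R[i].

(** The norm of [R[i]] takes its values in [R[i]]; this and the next lemmas move estimates to the
    real number [Re |z|]. *)
Lemma ltr_norm_complex (z : C) (e : R) : (`|z| < e%:C%C) = (Re `|z| < e).
Proof. by rewrite normc_def ltcR. Qed.

Lemma norm_complexE (z : C) : `|z| = (Re `|z|)%:C%C.
Proof. by rewrite normc_def. Qed.

Lemma Re_norm_ge0 (z : C) : 0 <= Re `|z|.
Proof. by rewrite normc_def sqrtr_ge0. Qed.

Lemma ler_Im_norm (z : C) : `|Im z| <= Re `|z|.
Proof. by rewrite normc_def -sqrtr_sqr ler_wsqrtr // lerDr sqr_ge0. Qed.

Lemma Re_norm_le (z : C) : Re `|z| <= `|Re z| + `|Im z|.
Proof.
rewrite normc_def -[leRHS]ger0_norm ?addr_ge0 // -sqrtr_sqr ler_wsqrtr //.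
rewrite sqrrD !real_normK ?num_real // lerD2r lerDl.
by rewrite mulrn_wge0 // mulr_ge0.
Qed.

Lemma ImD (z w : C) : Im (z + w) = Im z + Im w.
Proof. by case: z w => ? ? []. Qed.

Lemma Im_realMl (a : R) (z : C) : Im (a%:C%C * z) = a * Im z.
Proof. by case: z => x y /=; rewrite mul0r addr0. Qed.

Lemma Im_continuous : continuous (fun z : C^o => Im z : R^o).
Proof.
move=> z A /nbhs_ballP [e /= e0 eA]; apply/nbhs_ballP.
exists e%:C%C; first by rewrite /= ltcR.
move=> t; rewrite -ball_normE /= ltr_norm_complex => zt; apply: eA.
rewrite -ball_normE /=; apply: le_lt_trans zt.
by rewrite (_ : Im z - Im t = Im (z - t)) ?ler_Im_norm //; case: (z) (t) => ? ? [].
Qed.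

Lemma real_complex_continuous : continuous (fun x : R^o => x%:C%C : C^o).
Proof.
move=> x A /nbhs_ballP [e /= e0 eA]; apply/nbhs_ballP.
have er : 0 < Re e by move: e0; rewrite ltcE => /andP[].
have eE : e = (Re e)%:C%C by rewrite RRe_real // gtr0_real.
exists (Re e) => // t; rewrite -ball_normE /= => xt; apply: eA.
rewrite -ball_normE /= eE -(rmorphB (real_complex R)) normc_def ltcR /=.
by rewrite expr0n addr0 sqrtr_sqr.
Qed.

(** The basis consists of the balls with Gaussian rational centres and radii [1/(k+1)]. *)
Lemma Cn_second_countable n : @second_countable (Cn R n).
Proof.
pose c (q : 'rV[(rat * rat)%type]_n) : Cn R n :=
  \row_j (ratr (q 0 j).1 +i* ratr (q 0 j).2)%C.
exists [set ball (c qk.1) (qk.2.+1%:R^-1 : C) |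
  qk in [set: 'rV[(rat * rat)%type]_n * nat]].
  by apply: (card_le_trans (card_image_le _ _)); exact: countableP.
split; first by move=> _ [qk _ <-]; apply: ball_open; rewrite invr_gt0 ltr0n.
move=> x A /nbhs_ballP [e /= e0 eA].
have er : 0 < Re e by move: e0; rewrite ltcE => /andP[].
have eE : e = (Re e)%:C%C by rewrite RRe_real // gtr0_real.
(* With [2d < e], a ball of radius [d] that contains [x] lies in the ball of radius [e] about
   [x]. *)
have [k [d [d0 dd dE]]] : exists (k : nat) (d : R),
    [/\ 0 < d, d + d < Re e & (k.+1%:R^-1 : C) = d%:C%C].
  exists (Num.bound (2 / Re e)), ((Num.bound (2 / Re e)).+1%:R^-1).
  split; [by rewrite invr_gt0 ltr0n | | by rewrite fmorphV rmorph_nat].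
  have : 2 / Re e < (Num.bound (2 / Re e)).+1%:R.
    apply: lt_trans (archi_boundP _) _; last by rewrite ltr_nat.
    by rewrite divr_ge0 // ltW.
  rewrite ltr_pdivrMr // => h.
  by rewrite -mulr2n -[ltLHS]mulr_natl ltr_pdivrMr ?ltr0n // mulrC.
have rat_near (y : R) : exists q : rat, `|ratr q - y| < d / 2.
  have [|q] := @rat_in_itvoo R (y - d / 2) (y + d / 2); first by lra.
  by rewrite in_itv /= => ?; exists q; rewrite ltr_norml; lra.
have [q qx] : exists q, forall j, `|c q 0 j - x 0 j| < d%:C%C.
  have h j := rat_near (Re (x 0 j)); have h' j := rat_near (Im (x 0 j)).
  have [f fP] := choice h; have [g gP] := choice h'.
  exists (\row_j (f j, g j)) => j; rewrite !mxE /=.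
  rewrite ltr_norm_complex; apply: le_lt_trans (Re_norm_le _) _.
  have := fP j; have := gP j; case: (x 0 j) => u v /=; lra.
have d0' : (0 : C) < d%:C%C by rewrite ltcR.
exists (ball (c q) d%:C%C).
  split; first by exists (q, k); rewrite //= dE.
  by split=> // i j; rewrite ord1; exact: qx.
move=> y [_ qy]; apply: eA; split => // i j; rewrite ord1.
apply: (@lt_trans _ _ (d%:C%C + d%:C%C)); last first.
  by rewrite eE -(rmorphD (real_complex R)) ltcR.
apply: (@ball_triangle _ C^o (c q 0 j)); last exact: qy.
by rewrite -ball_normE /= distrC; exact: qx.
Qed.

End ComplexNumbers.

(** * Holomorphic maps read in charts *)

Section Holomorphy.
Variable R : realType.
Local Notation C := R[i].

(** Compatibility of the atlas of [M] reduces all target charts to [phi]. Of [N] only the inversion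
    identity is asked, so [complex_line] and products can be sources without being shown to be
    manifolds. *)
Lemma holomorphic_into_chart (N M : chartedSpace R) (U : set N)
    (phi : chart R M (mdim M)) (h : N -> Cn R (mdim M)) :
  complex_manifold M -> atlas M phi ->
  (forall chi p, atlas N chi -> chart_dom chi p ->
    chart_inv chi (chart_fun chi p) = p) ->
  (forall p, U p -> chart_codom phi (h p)) ->
  (forall p, U p -> {for p, continuous h}) ->
  (forall p chi, U p -> atlas N chi -> chart_dom chi p ->
    differentiable (h \o chart_inv chi) (chart_fun chi p)) ->
  holomorphic_on U (chart_inv phi \o h : N -> M).
Proof.
move=> [_ _ aM _ compM] aphi invN hcodom hcont hdiff p Up.
have [_ _ phiK _ invc] := aM _ aphi.
split.
  exact: (continuous_comp (hcont _ Up) (invc _ (hcodom _ Up))).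
move=> chi psi achi apsi pchi ppsi.
have [q qphi qE] := hcodom _ Up.
apply: (@differentiable_comp _ _ _ _ (h \o chart_inv chi)
  (chart_fun psi \o chart_inv phi)); first exact: hdiff.
rewrite /= invN // -qE; apply: compM => //.
by move: ppsi; rewrite /= -qE phiK.
Qed.

(** Dual reduction: compatibility in [N] lets the single source chart [phi] stand for all of them,
    and nothing is asked of the atlas of [M]. *)
Lemma holomorphic_from_chart (N M : chartedSpace R) (U : set N)
    (phi : chart R N (mdim N)) (k : Cn R (mdim N) -> M) :
  complex_manifold N -> atlas N phi -> U `<=` chart_dom phi ->
  (forall p, U p -> {for chart_fun phi p, continuous k}) ->
  (forall p psi, U p -> atlas M psi -> chart_dom psi (k (chart_fun phi p)) ->
    differentiable (chart_fun psi \o k) (chart_fun phi p)) ->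
  holomorphic_on U (k \o chart_fun phi : N -> M).
Proof.
move=> [_ _ aN _ compN] aphi Uphi kcont kdiff p Up.
have [_ _ _ phic _] := aN _ aphi.
split.
  exact: (continuous_comp (phic _ (Uphi _ Up)) (kcont _ Up)).
move=> chi psi achi apsi pchi ppsi.
have [_ _ chiK _ _] := aN _ achi.
rewrite (_ : _ \o _ \o _ = (chart_fun psi \o k) \o (chart_fun phi \o chart_inv chi)) //.
apply: (@differentiable_comp _ _ _ _ (chart_fun phi \o chart_inv chi)
  (chart_fun psi \o k)); first by apply: compN => //; exact: Uphi.
by rewrite /= chiK //; exact: kdiff.
Qed.

End Holomorphy.

(** * Kobayashi pseudodistance *)

Section PoincareDistance.
Variable R : realType.
Local Notation C := R[i].
Implicit Types a b : C.

Lemma ltr_norm1 (z : C) : (`|z| < 1) = (Re z ^+ 2 + Im z ^+ 2 < 1).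
Proof.
rewrite normc_def -[1 : C]/(1%:C%C) ltcR -[X in _ < X]sqrtr1 ltr_sqrt //.
Qed.

(** The identity [|1 - a^* b|^2 - |a - b|^2 = (1 - |a|^2) (1 - |b|^2)] has a positive right-hand
    side. *)
Lemma poincare_ratio_lt1 a b :
  `|a| < 1 -> `|b| < 1 -> Re `|(a - b) / (1 - a^* * b)| < 1.
Proof.
move=> a1 b1; rewrite -ltr_norm_complex.
have ne : 1 - a^* * b != 0.
  rewrite subr_eq0; apply/eqP => /(congr1 Num.norm).
  rewrite normrM norm_conjC normr1 => h.
  have : `|a| * `|b| < 1 by rewrite -[ltRHS]mulr1 ltr_pM.
  by rewrite -h ltxx.
rewrite normf_div ltr_pdivrMr ?normr_gt0 // mul1r.
rewrite -(@ltr_pXn2r _ 2) ?nnegrE //.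
move: a1 b1; rewrite !ltr_norm1 => a1 b1.
rewrite -!add_Re2_Im2 ltcR.
rewrite (_ : a^* = conjc a) //.
move: a1 b1 {ne}; case: a b => [x y] [u v] /= a1 b1.
rewrite -subr_gt0.
rewrite [ltRHS](_ : _ = (1 - (x ^+ 2 + y ^+ 2)) * (1 - (u ^+ 2 + v ^+ 2)));
  last by ring.
by rewrite mulr_gt0 // subr_gt0.
Qed.

Lemma poincare_dist_ge0 a b : `|a| < 1 -> `|b| < 1 -> 0 <= poincare_dist a b.
Proof.
move=> a1 b1; rewrite /poincare_dist ln_ge0 //.
have := poincare_ratio_lt1 a1 b1; have := Re_norm_ge0 ((a - b) / (1 - a^* * b)).
set t := Re _ => t0 t1; rewrite ler_pdivlMr; lra.
Qed.

Lemma poincare_distC a b : poincare_dist a b = poincare_dist b a.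
Proof.
rewrite /poincare_dist !normf_div (distrC a) -(norm_conjC (1 - a^* * b)).
by rewrite rmorphB rmorph1 rmorphM /= conjCK (mulrC a).
Qed.

Lemma poincare_dist0r (s : R) : 0 <= s ->
  poincare_dist 0 s%:C%C = ln ((1 + s) / (1 - s)).
Proof.
move=> s0; rewrite /poincare_dist conjC0 mul0r subr0 divr1 sub0r normrN.
by rewrite normc_def /= expr0n addr0 sqrtr_sqr ger0_norm.
Qed.

End PoincareDistance.

(** * Chains of discs and points at distance zero *)

Section KobayashiPseudodistance.
Variables (R : realType) (Y : chartedSpace R).
Local Notation C := R[i].
Implicit Types p q m : Y.

(** Recording the length of an individual chain keeps all estimates in [R]; the infimum in the
    extended reals enters only through [kobayashi_eq0]. *)
Definition linked p q (d : R) : Prop :=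
  exists k pt a b f, chain_of_discs p q k pt a b f /\
    d = \sum_(i < k) poincare_dist (a i) (b i).

Definition arb_close p q : Prop :=
  forall e : R, 0 < e -> exists2 d, d < e & linked p q d.

Lemma linked_disc (f : complex_line R -> Y) (a b : C) :
  holomorphic_on (@disc R) f -> `|a| < 1 -> `|b| < 1 ->
  linked (f a) (f b) (poincare_dist a b).
Proof.
move=> hf a1 b1.
exists 1%N, (fun i => if i is 0%N then f a else f b), (fun=> a), (fun=> b), (fun=> f).
by split; [split=> // -[]|rewrite big_ord1].
Qed.

Lemma linked_trans m p q d e : linked p m d -> linked m q e -> linked p q (d + e).
Proof.
move=> [k [pt [a [b [f [[k0 pt0 ptk ch] ->]]]]]].
move=> [k' [pt' [a' [b' [f' [[k0' pt0' ptk' ch'] ->]]]]]].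
pose g T (u v : nat -> T) i := if (i < k)%N then u i else v (i - k)%N.
exists (k + k')%N, (g _ pt pt'), (g _ a a'), (g _ b b'), (g _ f f').
rewrite /g; split.
  split; [by rewrite addn_gt0 k0 | by rewrite k0 | by rewrite ltnNge leq_addr addKn |].
  move=> i ikk'; case: (ltnP i k) => ik.
    have [? ? ? ? fb] := ch _ ik; split=> //; rewrite fb.
    (* On the last disc of the first chain, [i.+1 = k], the endpoint is read off the second list as
       [pt' 0], which is again [m]. *)
    case: ltnP => // ki; have -> : i.+1 = k by apply/eqP; rewrite eqn_leq ik.
    by rewrite subnn ptk pt0'.
  have [|? ? ? ? fb] := ch' (i - k)%N; first by rewrite ltn_subLR.
  by split=> //; rewrite fb ltnNge leqW //= subSn.
rewrite big_split_ord; congr (_ + _); apply: eq_bigr => i _ /=.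
  by rewrite ltn_ord.
by rewrite ltnNge leq_addr /= addKn.
Qed.

Lemma linked_sym p q d : linked p q d -> linked q p d.
Proof.
move=> [k [pt [a [b [f [[k0 pt0 ptk ch] ->]]]]]].
(* The reversed chain takes disc [k - 1 - i] at position [i], with its two marked points
   exchanged. *)
exists k, (fun i => pt (k - i)%N), (fun i => b (k - i.+1)%N), (fun i => a (k - i.+1)%N),
  (fun i => f (k - i.+1)%N).
split.
  split; rewrite ?subn0 ?subnn // => i ik.
  have [|? ? ? ? ?] := ch (k - i.+1)%N; first by rewrite ltn_subrL.
  by split=> //; rewrite -[(k - i)%N]subnSK.
by rewrite (reindex_inj rev_ord_inj); apply: eq_bigr => i _; rewrite poincare_distC.
Qed.

Lemma arb_close_sym p q : arb_close p q -> arb_close q p.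
Proof. by move=> h e /h[d de] /linked_sym; exists d. Qed.

Lemma arb_close_trans m p q : arb_close p m -> arb_close m q -> arb_close p q.
Proof.
move=> h h' e e0; have e20 : 0 < e / 2 by rewrite divr_gt0.
have [d de l] := h _ e20; have [d' de' l'] := h' _ e20.
by exists (d + d'); [lra|exact: linked_trans l l'].
Qed.

Lemma kobayashi_eq0 p q : arb_close p q -> kobayashi p q = 0%E.
Proof.
move=> h; apply/eqP; rewrite eq_le; apply/andP; split.
  apply/lee_addgt0Pr => e /h[d de [k [pt [a [b [f [ch dE]]]]]]].
  rewrite add0e; apply: (@le_trans _ _ d%:E); last by rewrite lee_fin ltW.
  by apply: ereal_inf_lbound; exists k, pt, a, b, f; rewrite dE.
apply: le_ereal_inf_tmp => _ [k [pt [a [b [f [[_ _ _ ch] ->]]]]]].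
rewrite lee_fin; apply: sumr_ge0 => i _.
by have [? ? _ _ _] := ch i (ltn_ord i); exact: poincare_dist_ge0.
Qed.

Hypothesis mY : complex_manifold Y.

(** The affine disc [z |-> x + (z / s) v] sends [0] to [x] and [s] to [x + v]; it stays in the chart
    because [|z / s| < 1 / s]. The bound is the Poincaré distance from [0] to [s]. *)
Lemma linked_chart_disc phi (x v : Cn R (mdim Y)) (s : R) :
  atlas Y phi -> 0 < s < 1 ->
  (forall t : C, `|t| < s^-1%:C%C -> chart_codom phi (x + t *: v)) ->
  linked (chart_inv phi x) (chart_inv phi (x + v)) (ln ((1 + s) / (1 - s))).
Proof.
move=> aphi /andP[s0 s1] hx.
pose h (z : complex_line R) : Cn R (mdim Y) := x + ((s^-1)%:C%C * (z : C)) *: v.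
have dh (z : C^o) : differentiable (fun z : C^o => x + ((s^-1)%:C%C * z) *: v) z.
  apply: differentiableD; first exact: differentiable_cst.
  apply: differentiableZl; exact: differentiableZ.
have hol : holomorphic_on (@disc R) (chart_inv phi \o h : complex_line R -> Y).
  have invN chi (p : complex_line R) : atlas (complex_line R) chi -> chart_dom chi p ->
      chart_inv chi (chart_fun chi p) = p by move=> -> _ /=; rewrite mxE.
  have hcodom (z : complex_line R) : disc z -> chart_codom phi (h z).
    move=> z1; apply: hx; rewrite normrM ger0_norm ?ler0c ?invr_ge0 ?(ltW s0) //.
    by rewrite -[ltRHS]mulr1 ltr_pM2l // ltcR invr_gt0.
  have hcont (z : complex_line R) : disc z -> {for z, continuous h}.
    by move=> _; exact: differentiable_continuous (dh z).
  have hdiff (z : complex_line R) chi : disc z -> atlas (complex_line R) chi ->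
      chart_dom chi z -> differentiable (h \o chart_inv chi) (chart_fun chi z).
    move=> _ -> _.
    apply: (@differentiable_comp _ (Cn R 1) _ _ (fun v : 'rV[C]_1 => v 0 0 : C^o)
      (fun z : C^o => x + ((s^-1)%:C%C * z) *: v)).
      exact: differentiable_coord.
    exact: dh.
  exact: (holomorphic_into_chart mY aphi invN hcodom hcont hdiff).
rewrite -poincare_dist0r ?ltW //.
rewrite (_ : chart_inv phi x = (chart_inv phi \o h) 0); last first.
  by rewrite /= /h mulr0 scale0r addr0.
rewrite (_ : chart_inv phi (x + v) = (chart_inv phi \o h) s%:C%C); last first.
  by rewrite /= /h -rmorphM mulVf ?gt_eqF // scale1r.
apply: linked_disc => //; first by rewrite normr0.
by rewrite ger0_norm ?ler0c ?ltW // ltcR.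
Qed.

End KobayashiPseudodistance.

(** * Cayley transform *)

Section Cayley.
Variable R : realType.
Local Notation C := R[i].
Implicit Types w z : C.

Definition cayley w : C := (w - 'i%C) / (w + 'i%C).
Definition inv_cayley z : C := 'i%C * (1 + z) / (1 - z).

Lemma upper_addi_neq0 w : 0 < Im w -> w + 'i%C != 0.
Proof.
case: w => x y /= y0; rewrite eq_complex /= negb_and; apply/orP; right.
by rewrite gt_eqF // addr_gt0.
Qed.

Lemma disc_sub1_neq0 z : `|z| < 1 -> 1 - z != 0.
Proof.
move=> z1; rewrite subr_eq0; apply/eqP => zE.
by move: z1; rewrite -zE normr1 ltxx.
Qed.

(** Here [|w + i|^2 - |w - i|^2 = 4 Im w]. *)
Lemma cayley_disc w : 0 < Im w -> `|cayley w| < 1.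
Proof.
move=> w0; have ne := upper_addi_neq0 w0.
rewrite /cayley normf_div ltr_pdivrMr ?normr_gt0 // mul1r.
rewrite -(@ltr_pXn2r _ 2) ?nnegrE // -!add_Re2_Im2 ltcR.
by move: w0; case: w {ne} => x y /=; nra.
Qed.

Lemma cayleyK w : 0 < Im w -> inv_cayley (cayley w) = w.
Proof.
move=> w0; have ne := upper_addi_neq0 w0.
have i0 : 'i%C != 0 :> C by rewrite complexiE neq0Ci.
rewrite /inv_cayley /cayley; field; rewrite ne /=.
(* After clearing the inner quotient, the remaining denominator is [(w + i) - (w - i) = 2i]. *)
by rewrite [X in X != _](_ : _ = 2 * 'i%C) ?mulf_neq0 ?pnatr_eq0 //; ring.
Qed.

Lemma inv_cayleyK z : `|z| < 1 -> cayley (inv_cayley z) = z.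
Proof.
move=> z1; have ne := disc_sub1_neq0 z1.
have i0 : 'i%C != 0 :> C by rewrite complexiE neq0Ci.
rewrite /inv_cayley /cayley; field; rewrite ne /=.
by rewrite [X in X != _](_ : _ = 2 * 'i%C) ?mulf_neq0 ?pnatr_eq0 //; ring.
Qed.

Lemma inv_cayley_upper z : `|z| < 1 -> 0 < Im (inv_cayley z).
Proof.
move=> z1; have ne := disc_sub1_neq0 z1.
(* Making the denominator real leaves the sign to [Im (i (1 + z) conj(1 - z)) = 1 - |z|^2]. *)
have -> : inv_cayley z = (`|1 - z| ^- 2) * ('i%C * (1 + z) * conjc (1 - z)).
  by rewrite /inv_cayley invc_norm mulrCA mulrA.
have : 0 < Re `|1 - z|.
  by rewrite -(@ltcR R) RRe_real ?normr_real // normr_gt0.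
rewrite norm_complexE; set r := Re _ => r0.
rewrite -rmorphXn -fmorphV Im_realMl mulr_gt0 ?invr_gt0 ?exprn_gt0 //.
by move: z1; rewrite ltr_norm1; case: z {ne r r0} => x y /=; nra.
Qed.

Lemma differentiable_cayley w : 0 < Im w ->
  differentiable (cayley : C^o -> C^o) (w : C^o).
Proof.
move=> w0.
apply: (@differentiableM _ C^o (fun w : C^o => w - 'i%C)
  (fun w : C^o => (w + 'i%C)^-1)).
  exact: ex_diff.
apply: (@differentiableV _ C^o (fun w : C^o => w + 'i%C)); first exact: ex_diff.
exact: upper_addi_neq0.
Qed.

Lemma differentiable_inv_cayley z : `|z| < 1 ->
  differentiable (inv_cayley : C^o -> C^o) (z : C^o).
Proof.
move=> z1.
apply: (@differentiableM _ C^o (fun z : C^o => 'i%C * (1 + z))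
  (fun z : C^o => (1 - z)^-1)).
  exact: ex_diff.
apply: (@differentiableV _ C^o (fun w : C^o => 1 - w)); first exact: ex_diff.
exact: disc_sub1_neq0.
Qed.

End Cayley.

(** * Flat affine bundles of half-planes *)

Section FlatBundle.
Variables (R : realType) (n : nat).
Local Notation C := R[i].
Variables (E : set (Cn R n)) (I : Type) (D : I -> set (Cn R n)).
(* As a topological space the bundle is E x H; only the complex structure is
   twisted: over [D i] the fibre coordinate is [alpha i * u + beta i], and [flat]
   makes the transition maps locally independent of the base point. *)
Variables (alpha beta : I -> Cn R n -> R).
Hypothesis oD : forall i, open (D i).
Hypothesis ED : E = \bigcup_i D i.
Hypothesis alpha_cont : forall i x, D i x -> {for x, continuous (alpha i : _ -> R^o)}.
Hypothesis beta_cont : forall i x, D i x -> {for x, continuous (beta i : _ -> R^o)}.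
Hypothesis alpha_gt0 : forall i x, 0 < alpha i x.
Hypothesis flat : forall i j x, D i x -> D j x -> exists c d : R,
  \forall y \near x, alpha j y = c * alpha i y /\ beta j y = c * beta i y + d.
Variables (x0 : Cn R n) (Ex0 : E x0).

Definition total_set : set (Cn R (n + 1)) :=
  [set v | E (lsubmx v) /\ 0 < Im (last_coord v)].

Lemma total_join (x : Cn R n) (w : C) : E x -> 0 < Im w -> total_set (join x w).
Proof. by move=> Ex w0; split; rewrite ?lsubmx_join ?last_coord_join. Qed.

Lemma total_base : total_set (join x0 'i%C).
Proof. by apply: total_join => //=; exact: ltr01. Qed.

Definition base_pt : E := SigSub (mem_set Ex0).
Definition total_pt : total_set := SigSub (mem_set total_base).

Local Notation inB := (to_sub base_pt).
Local Notation inY := (to_sub total_pt).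

Definition frame i (v : Cn R (n + 1)) : Cn R (n + 1) :=
  join (lsubmx v)
    ((alpha i (lsubmx v))%:C%C * last_coord v + (beta i (lsubmx v))%:C%C).

Definition unframe i (v : Cn R (n + 1)) : Cn R (n + 1) :=
  join (lsubmx v)
    (((alpha i (lsubmx v))^-1)%:C%C * (last_coord v - (beta i (lsubmx v))%:C%C)).

Lemma frameK i : cancel (frame i) (unframe i).
Proof.
move=> v; rewrite /frame /unframe !lsubmx_join !last_coord_join addrK.
by rewrite mulrA -rmorphM mulVf ?gt_eqF // mul1r join_lsubmx.
Qed.

Lemma unframeK i : cancel (unframe i) (frame i).
Proof.
move=> v; rewrite /frame /unframe !lsubmx_join !last_coord_join.
by rewrite mulrA -rmorphM mulfV ?gt_eqF // mul1r subrK join_lsubmx.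
Qed.

Lemma lsubmx_frame i v : lsubmx (frame i v) = lsubmx v.
Proof. by rewrite lsubmx_join. Qed.

Lemma lsubmx_unframe i v : lsubmx (unframe i v) = lsubmx v.
Proof. by rewrite lsubmx_join. Qed.

(** Real coefficients with positive slope preserve the half-plane, so every twisted chart again has
    image [D i x H]. *)
Lemma Im_frame i v : 0 < Im (last_coord v) -> 0 < Im (last_coord (frame i v)).
Proof.
move=> v0; rewrite last_coord_join.
rewrite ImD Im_realMl /= addr0.
by rewrite mulr_gt0.
Qed.

Lemma Im_unframe i v : 0 < Im (last_coord v) -> 0 < Im (last_coord (unframe i v)).
Proof.
move=> v0; rewrite last_coord_join Im_realMl ImD /= oppr0 addr0.
by rewrite mulr_gt0 // invr_gt0.
Qed.

Lemma D_sub i : D i `<=` E.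
Proof. by move=> x Dx; rewrite ED; exists i. Qed.

Lemma open_E : open E.
Proof. by rewrite ED; apply: bigcup_open. Qed.

Lemma lsubmx_continuous : continuous (fun v : Cn R (n + 1) => lsubmx v : Cn R n).
Proof. exact: continuous_lsubmx. Qed.

Lemma Im_last_continuous : continuous (fun v : Cn R (n + 1) => Im (last_coord v) : R^o).
Proof.
move=> v.
apply: (@continuous_comp _ _ _ (fun v : Cn R (n + 1) => last_coord v : C^o)
  (fun z : C^o => Im z : R^o)).
  exact: last_coord_continuous.
exact: Im_continuous.
Qed.

Definition chart_image (U : set (Cn R n)) : set (Cn R (n + 1)) :=
  [set v | U (lsubmx v) /\ 0 < Im (last_coord v)].

Lemma open_chart_image U : open U -> open (chart_image U).
Proof.
move=> oU; apply: openI.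
  by move/continuousP : lsubmx_continuous => /(_ _ oU).
by move/continuousP : Im_last_continuous => /(_ _ (@open_gt R 0)).
Qed.

Lemma open_total_set : open total_set.
Proof. exact: open_chart_image open_E. Qed.

Lemma real_complex_continuous_at (X : topologicalType) (g : X -> R^o) x :
  {for x, continuous g} -> {for x, continuous (fun t => (g t)%:C%C : C^o)}.
Proof.
move=> gc; apply: (@continuous_comp _ _ _ g (fun x : R^o => x%:C%C : C^o)).
  exact: gc.
exact: real_complex_continuous.
Qed.

Lemma pair_continuous_at (X Y Z : topologicalType) (f : X -> Y) (g : X -> Z) x :
  {for x, continuous f} -> {for x, continuous g} ->
  {for x, continuous (fun t => (f t, g t))}.
Proof. by move=> fc gc; exact: cvg_pair. Qed.

Lemma lsubmx_continuous_at (X : topologicalType) (g : Cn R n -> X) v :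
  {for lsubmx v, continuous g} ->
  {for v, continuous (fun v : Cn R (n + 1) => g (lsubmx v))}.
Proof.
move=> gc.
apply: (@continuous_comp _ _ _ (fun v : Cn R (n + 1) => lsubmx v : Cn R n) g).
  exact: lsubmx_continuous.
exact: gc.
Qed.

Lemma frame_continuous_at i v : D i (lsubmx v) -> {for v, continuous (frame i)}.
Proof.
move=> Dv.
have ac : {for v, continuous (fun v => alpha i (lsubmx v) : R^o)}.
  exact: lsubmx_continuous_at (alpha_cont Dv).
have bc : {for v, continuous (fun v => beta i (lsubmx v) : R^o)}.
  exact: lsubmx_continuous_at (beta_cont Dv).
apply: join_continuous_at; first exact: lsubmx_continuous.
apply: continuousD; last first.
  exact: real_complex_continuous_at bc.
apply: continuousM; last exact: last_coord_continuous.
exact: real_complex_continuous_at ac.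
Qed.

Lemma unframe_continuous_at i v : D i (lsubmx v) -> {for v, continuous (unframe i)}.
Proof.
move=> Dv.
have ac : {for v, continuous (fun v => alpha i (lsubmx v) : R^o)}.
  exact: lsubmx_continuous_at (alpha_cont Dv).
have bc : {for v, continuous (fun v => beta i (lsubmx v) : R^o)}.
  exact: lsubmx_continuous_at (beta_cont Dv).
have avc : {for v, continuous (fun v => (alpha i (lsubmx v))^-1 : R^o)}.
  by apply: continuousV => //; rewrite gt_eqF.
apply: join_continuous_at; first exact: lsubmx_continuous.
exact: (continuousM (real_complex_continuous_at avc)
  (continuousB (@last_coord_continuous _ n v) (real_complex_continuous_at bc))).
Qed.

Definition base_chart : chart R E n :=
  Chart [set: E] (val : E -> Cn R n) (inB : Cn R n -> E).

Definition total_chart i : chart R total_set (n + 1) :=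
  Chart [set p : total_set | D i (lsubmx (val p))]
    (fun p => frame i (val p)) (fun v => inY (unframe i v)).

Definition base_space : chartedSpace R :=
  @ChartedSpace R E n [set base_chart].

Definition total_space : chartedSpace R :=
  @ChartedSpace R total_set (n + 1) [set total_chart i | i in [set: I]].

Lemma base_manifold : complex_manifold base_space.
Proof.
have codomE : chart_codom base_chart = E.
  apply/seteqP; split => [_ [p _ <-]|x Ex]; first exact: set_typeP.
  by exists (inB x) => //; exact: val_to_sub.
split.
- exact: set_type_hausdorff (@norm_hausdorff _ _).
- exact: set_type_second_countable (@Cn_second_countable _ _).
- move=> _ ->; split; rewrite ?codomE.
  + exact: openT.
  + exact: open_E.
  + by move=> p _; exact: to_sub_val.
  + by move=> p _; exact: val_continuous.
  + by move=> v Ev; apply: to_sub_continuous_at => //; exact: open_E.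
- by move=> p; exists base_chart.
- move=> _ _ -> -> p _ _ /=.
  (* The transition map is the identity on the open set [E] only; elsewhere [inB] returns its
     default point. *)
  apply: (@near_eq_differentiable _ _ _ id); last exact: ex_diff.
  have := open_nbhs_nbhs (conj open_E (set_typeP p)).
  by apply: filterS => v Ev; exact/esym/val_to_sub.
Qed.

Lemma total_unframe i v : chart_image (D i) v -> total_set (unframe i v).
Proof.
by move=> [Dv v0]; split; [rewrite lsubmx_unframe; exact: D_sub Dv|exact: Im_unframe].
Qed.

Lemma total_chart_codom i : chart_codom (total_chart i) = chart_image (D i).
Proof.
apply/seteqP; split => [_ [p /= Dp <-]|v iv].
  split; first by rewrite lsubmx_frame.
  by apply: Im_frame; case: (set_typeP p).
have vE : val (inY (unframe i v)) = unframe i v.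
  exact: val_to_sub (total_unframe iv).
exists (inY (unframe i v)) => /=.
  by rewrite [X in lsubmx X]vE lsubmx_unframe; case: iv.
by rewrite [X in frame i X]vE unframeK.
Qed.

Lemma total_chartK i p : chart_dom (total_chart i) p ->
  chart_inv (total_chart i) (chart_fun (total_chart i) p) = p.
Proof. by move=> _ /=; rewrite frameK to_sub_val. Qed.

Lemma val_total_chart_inv i v : chart_image (D i) v ->
  val (chart_inv (total_chart i) v) = unframe i v.
Proof. by move=> /total_unframe tv; exact: val_to_sub. Qed.

Lemma nbhs_chart_image i p : chart_dom (total_chart i) p ->
  nbhs (chart_fun (total_chart i) p) (chart_image (D i)).
Proof.
move=> Dp; apply: open_nbhs_nbhs; split; first exact: open_chart_image.
by rewrite -total_chart_codom; exists p.
Qed.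

(** Each [frame i] is merely continuous in the base point, but the transition maps are holomorphic:
    [flat] makes them locally [(x, w) |-> (x, c w + d)] with constant [c] and [d]. *)
Lemma total_manifold : complex_manifold total_space.
Proof.
split.
- exact: set_type_hausdorff (@norm_hausdorff _ _).
- exact: set_type_second_countable (@Cn_second_countable _ _).
- move=> _ [i _ <-]; split; rewrite ?total_chart_codom.
  + exists (lsubmx @^-1` D i) => //.
    by move/continuousP : lsubmx_continuous => /(_ _ (@oD i)).
  + exact: open_chart_image.
  + exact: total_chartK.
  + move=> p Dp.
    exact: (continuous_comp (@val_continuous _ _ p) (frame_continuous_at Dp)).
  + move=> v Dv; have tv := total_unframe Dv; case: Dv => Dv _.
    apply: (@continuous_comp _ _ _ (unframe i) inY).
      exact: unframe_continuous_at.
    by apply: to_sub_continuous_at => //; exact: open_total_set.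
- move=> p; have [Ep _] := set_typeP p.
  by move: Ep; rewrite ED => -[i _ Dp]; exists (total_chart i) => //; exists i.
- move=> _ _ [i _ <-] [j _ <-] p Dip Djp.
  have [c [d cd]] := flat Dip Djp.
  have dlin v : differentiable (fun v : Cn R (n + 1) =>
      join (lsubmx v) (c%:C%C * last_coord v + d%:C%C)) v.
    apply: differentiable_join; first exact: differentiable_lsubmx.
    apply: differentiableD; last exact: differentiable_cst.
    by apply: differentiableZ; exact: differentiable_last_coord.
  apply: near_eq_differentiable (dlin _).
  have ci := nbhs_chart_image Dip.
  have cdi : \forall v \near chart_fun (total_chart i) p,
      alpha j (lsubmx v) = c * alpha i (lsubmx v) /\
      beta j (lsubmx v) = c * beta i (lsubmx v) + d.
    have nx : nbhs (lsubmx (chart_fun (total_chart i) p) : Cn R n)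
        [set y | alpha j y = c * alpha i y /\ beta j y = c * beta i y + d].
      by rewrite /= lsubmx_frame.
    exact: (lsubmx_continuous nx).
  (* With [u = (w - beta i) / alpha i], the [j]-th coordinate is
     [c alpha i u + c beta i + d = c w + d]. *)
  apply: filterS2 ci cdi => v iv [av bv].
  rewrite /comp /= [X in frame j X](val_total_chart_inv iv).
  rewrite /frame lsubmx_unframe av bv; congr join.
  rewrite last_coord_join rmorphM mulrA -(mulrA c%:C%C) -rmorphM mulfV ?gt_eqF //.
  by rewrite mulr1 rmorphD rmorphM mulrBr addrA subrK.
Qed.

Definition bundle_proj (p : total_space) : base_space := inB (lsubmx (val p)).

Lemma val_bundle_proj p : val (bundle_proj p) = lsubmx (val p).
Proof. by apply: val_to_sub; have [] := set_typeP p. Qed.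

Lemma atlas_total_chart i : atlas total_space (total_chart i).
Proof. by exists i. Qed.

Lemma frame_chart_image i (p : total_space) : chart_dom (total_chart i) p ->
  chart_image (D i) (frame i (val p)).
Proof. by move=> Dp; rewrite -total_chart_codom; exists p. Qed.

(** Frames do not move the base coordinate, so in every chart the projection is the linear map
    [lsubmx]. *)
Lemma holomorphic_bundle_proj :
  holomorphic_on [set: total_space] (bundle_proj : total_space -> base_space).
Proof.
have invN chi (p : total_space) : atlas total_space chi -> chart_dom chi p ->
  chart_inv chi (chart_fun chi p) = p by move=> [i _ <-]; exact: total_chartK.
pose h (p : total_space) : Cn R n := lsubmx (val p).
have hcodom p : [set: total_space] p -> chart_codom base_chart (h p).
  by move=> _; exists (bundle_proj p) => //; exact: val_bundle_proj.
have hcont p : [set: total_space] p -> {for p, continuous h}.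
  move=> _; apply: (@continuous_comp _ _ _ (val : total_set -> Cn R (n + 1))
    (fun v : Cn R (n + 1) => lsubmx v : Cn R n)).
    exact: val_continuous.
  exact: lsubmx_continuous.
have hdiff p chi : [set: total_space] p -> atlas total_space chi -> chart_dom chi p ->
    differentiable (h \o chart_inv chi) (chart_fun chi p).
  move=> _ [i _ <-] Dp.
  apply: near_eq_differentiable (differentiable_lsubmx _).
  apply: filterS (nbhs_chart_image Dp) => v iv.
  by rewrite /h /= [X in _ = lsubmx X](val_total_chart_inv iv) lsubmx_unframe.
exact: (holomorphic_into_chart base_manifold (erefl : atlas base_space base_chart)
  invN hcodom hcont hdiff).
Qed.

Lemma nbhs_E x : E x -> nbhs x E.
Proof. by move=> Ex; apply: open_nbhs_nbhs; split => //; exact: open_E. Qed.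

Lemma near_total (v : Cn R (n + 1)) : E (lsubmx v) ->
  \forall u \near v, val (inB (lsubmx u)) = lsubmx u.
Proof.
move=> Ev; have nE : nbhs v [set u : Cn R (n + 1) | E (lsubmx u)].
  exact: (lsubmx_continuous (nbhs_E Ev)).
by apply: filterS nE => u Eu; exact: val_to_sub.
Qed.

(** * Local trivializations through the Cayley transform *)

Section Trivialization.
Variable i : I.

Let U : set base_space := [set b | D i (val b)].
Let W := prod_space base_space (complex_line R).

Let V : set W := U `*` @disc R.

(** Read in the chart [total_chart i], the trivialization is [k] and its inverse is [h]: the base
    stays fixed and the half-plane goes to the disc. *)
Let k (v : Cn R (n + 1)) : W := (inB (lsubmx v), cayley (last_coord v)).
Let h (q : W) : Cn R (n + 1) := join (val q.1) (inv_cayley q.2).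

Lemma holomorphic_trivialization :
  holomorphic_on (bundle_proj @^-1` U)
    (k \o chart_fun (total_chart i) : total_space -> W).
Proof.
have Usub : bundle_proj @^-1` U `<=` chart_dom (total_chart i).
  by move=> p; rewrite /U /= val_bundle_proj.
apply: (holomorphic_from_chart total_manifold (atlas_total_chart i) Usub) => p.
  move=> /Usub Dp; have [Dv v0] := frame_chart_image Dp.
  have kc1 : {for frame i (val p),
      continuous (fun v : Cn R (n + 1) => inB (lsubmx v))}.
    apply: (lsubmx_continuous_at (g := inB)).
    by apply: to_sub_continuous_at; [exact: open_E|exact: D_sub Dv].
  have kc2 : {for frame i (val p),
      continuous (fun v : Cn R (n + 1) => cayley (last_coord v) : C^o)}.
    apply: (@continuous_comp _ _ _ (fun v : Cn R (n + 1) => last_coord v : C^o)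
      (cayley (R := R) : C^o -> C^o)).
      exact: last_coord_continuous.
    exact: differentiable_continuous (differentiable_cayley v0).
  exact: pair_continuous_at kc1 kc2.
move=> psi /Usub Dp [_ [_ [-> -> ->]]] _.
have [Dv v0] := frame_chart_image Dp.
apply: (@near_eq_differentiable _ (Cn R (n + 1)) (Cn R (n + 1))
  (fun v => join (lsubmx v) (cayley (last_coord v)))).
  apply: filterS (near_total (D_sub Dv)) => v vE.
  by rewrite /k /= [X in _ = row_mx X _]vE.
apply: differentiable_join; first exact: differentiable_lsubmx.
apply: (@differentiable_comp _ _ _ _ (fun v : Cn R (n + 1) => last_coord v : C^o)
    (cayley (R := R) : C^o -> C^o)).
  exact: differentiable_last_coord.
exact: differentiable_cayley.
Qed.

Lemma holomorphic_trivialization_inv :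
  holomorphic_on V (chart_inv (total_chart i) \o h : W -> total_space).
Proof.
have invN chi (q : W) : atlas W chi -> chart_dom chi q ->
    chart_inv chi (chart_fun chi q) = q.
  move=> [_ [_ [-> -> ->]]] _; case: q => b z; rewrite /= row_mxKl row_mxKr mxE.
  by congr pair; exact: (@to_sub_val _ E base_pt b).
have hcodom (q : W) : V q -> chart_codom (total_chart i) (h q).
  move=> [Uq q1]; rewrite total_chart_codom.
  rewrite /chart_image /h /= lsubmx_join last_coord_join.
  by split => //; exact: inv_cayley_upper.
have hcont (q : W) : V q -> {for q, continuous h}.
  move=> [Uq q1]; apply: join_continuous_at.
    apply: (@continuous_comp _ _ _ (fst : E * C^o -> E) (val : E -> Cn R n)).
      exact: cvg_fst.
    exact: val_continuous.
  apply: (@continuous_comp _ _ _ (snd : E * C^o -> C^o)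
    (inv_cayley (R := R) : C^o -> C^o)).
    exact: cvg_snd.
  exact: differentiable_continuous (differentiable_inv_cayley q1).
have hdiff (q : W) chi : V q -> atlas W chi -> chart_dom chi q ->
    differentiable (h \o chart_inv chi) (chart_fun chi q).
  move=> [Uq q1] [_ [_ [-> -> ->]]] _.
  set v := chart_fun _ _.
  have Ev : E (lsubmx v) by rewrite /v /= row_mxKl; exact: D_sub Uq.
  have v1 : `|last_coord v| < 1 by rewrite /last_coord /v /= row_mxKr mxE.
  apply: (@near_eq_differentiable _ (Cn R (n + 1)) (Cn R (n + 1))
    (fun v => join (lsubmx v) (inv_cayley (last_coord v)))).
    apply: filterS (near_total Ev) => u uE.
    by rewrite /h /= [X in _ = join X _]uE.
  apply: differentiable_join; first exact: differentiable_lsubmx.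
  apply: (@differentiable_comp _ _ _ _ (fun v : Cn R (n + 1) => last_coord v : C^o)
    (inv_cayley (R := R) : C^o -> C^o)).
    exact: differentiable_last_coord.
  exact: differentiable_inv_cayley.
exact: (holomorphic_into_chart total_manifold (atlas_total_chart i)
  invN hcodom hcont hdiff).
Qed.

Lemma biholomorphic_trivialization :
  biholomorphic_on (bundle_proj @^-1` U) V
    (k \o chart_fun (total_chart i) : total_space -> W).
Proof.
exists (chart_inv (total_chart i) \o h); split.
- exact: holomorphic_trivialization.
- exact: holomorphic_trivialization_inv.
- move=> p; rewrite /U /= val_bundle_proj => Dp.
  have [Dv v0] := frame_chart_image Dp.
  have vE : val (inB (lsubmx (frame i (val p)))) = lsubmx (frame i (val p)).
    by apply: val_to_sub; exact: D_sub Dv.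
  split; first by split; [exact: (eq_ind_r (D i) Dv vE)|exact: cayley_disc].
  rewrite /h /= [X in join X _]vE cayleyK // join_lsubmx.
  exact: total_chartK.
- move=> [b z] [/= Db z1].
  have hb : chart_image (D i) (h (b, z)).
    rewrite /chart_image /h /= lsubmx_join last_coord_join.
    by split => //; exact: inv_cayley_upper.
  have vE := val_total_chart_inv hb; rewrite /= in vE.
  split.
    by rewrite /U /= val_bundle_proj [X in lsubmx X]vE lsubmx_unframe lsubmx_join.
  rewrite /k /= [X in frame i X]vE unframeK lsubmx_join last_coord_join inv_cayleyK //.
  by rewrite to_sub_val.
Qed.

End Trivialization.

Lemma total_disc_bundle : disc_bundle bundle_proj.
Proof.
split; first exact: holomorphic_bundle_proj.
move=> b; have := set_typeP b; rewrite {1}ED => -[i _ Db].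
exists [set b | D i (val b)]; split => //.
  by exists (D i) => //; exact: oD.
exists (fun p => (inB (lsubmx (frame i (val p))),
                  cayley (last_coord (frame i (val p))))).
split; first exact: biholomorphic_trivialization.
by move=> p _ /=; rewrite lsubmx_frame.
Qed.

End FlatBundle.

(** * Complex lines and dense holonomy *)

Section MoreDiscs.
Variable R : realType.
Local Notation C := R[i].

Lemma poincare_radius (e : R) : 0 < e ->
  exists2 s, 0 < s < 1 & ln ((1 + s) / (1 - s)) = e.
Proof.
move=> e0; have x1 : 1 < expR e by rewrite expR_gt1.
have ne : expR e + 1 != 0 by rewrite gt_eqF // addr_gt0 // expR_gt0.
(* This is [tanh (e / 2)], the solution [s] of [(1 + s) / (1 - s) = expR e]. *)
exists ((expR e - 1) / (expR e + 1)).
  rewrite divr_gt0 ?subr_gt0 ?addr_gt0 ?expR_gt0 //=.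
  by rewrite ltr_pdivrMr ?addr_gt0 ?expR_gt0 // mul1r ltrD2l; lra.
rewrite -[RHS]expRK; congr ln; field; rewrite ne /=.
by rewrite [X in X != 0](_ : _ = 2) ?pnatr_eq0 //; ring.
Qed.

(** A whole complex line in the chart contains affine discs of every radius [1 / s], and the cost of
    reaching [x + v] tends to 0 with [s]. *)
Lemma arb_close_line (Y : chartedSpace R) (phi : chart R Y (mdim Y))
    (x v : Cn R (mdim Y)) :
  complex_manifold Y -> atlas Y phi ->
  (forall t : C, chart_codom phi (x + t *: v)) ->
  arb_close (chart_inv phi x) (chart_inv phi (x + v)).
Proof.
move=> mY aphi hx e e0.
have [|s s01 sE] := @poincare_radius (e / 2); first by lra.
exists (e / 2); first by lra.
by rewrite -sE; apply: linked_chart_disc.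
Qed.

(* The powers of [sqrt 2 - 1] are positive elements of Z + Z sqrt 2 tending to 0;
   carrying [sqrt 2 * w ^+ m] along makes the induction go through. *)
Lemma dense_subgroup (S : set R) :
  S 1 -> S (Num.sqrt 2) -> (forall x y, S x -> S y -> S (x - y)) ->
  forall s d : R, 0 < d -> exists2 s', S s' & `|s - s'| < d.
Proof.
move=> S1 S2 SB s d d0.
have S0 : S 0 by rewrite -(subrr (1 : R)); exact: SB.
have SN x : S x -> S (- x) by move=> Sx; rewrite -sub0r; exact: SB.
have SD x y : S x -> S y -> S (x + y).
  by move=> Sx Sy; rewrite -[y]opprK; apply: SB => //; exact: SN.
have Sn x (m : nat) : S x -> S (x *+ m).
  by move=> Sx; elim: m => [|m IH]; rewrite ?mulr0n // mulrS; exact: SD.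
have Sz x (m : int) : S x -> S (x *~ m).
  by move=> Sx; case: m => m; [exact: Sn|rewrite NegzE mulrNz; exact/SN/Sn].
pose w : R := Num.sqrt 2 - 1.
have sq2 : Num.sqrt 2 * Num.sqrt 2 = 2 :> R by rewrite -expr2 sqr_sqrtr.
have sqge : 0 <= Num.sqrt 2 :> R by rewrite sqrtr_ge0.
have w0 : 0 < w by rewrite /w; nra.
have w1 : `|w| < 1 by rewrite gtr0_norm // /w; nra.
have Sw (m : nat) : S (w ^+ m) /\ S (Num.sqrt 2 * w ^+ m).
  elim: m => [|m [IH1 IH2]]; first by rewrite expr0 mulr1.
  rewrite exprS (_ : w * _ = Num.sqrt 2 * w ^+ m - w ^+ m); last by rewrite /w; ring.
  split; first exact: SB.
  rewrite mulrBr mulrA sq2 mulr_natl; apply: SB => //; exact: Sn.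
have [m wm] : exists m : nat, w ^+ m < d.
  have /cvgrPdist_lt/(_ _ d0) [N _ /(_ N (leqnn N))] := cvg_expr w1.
  by rewrite /= sub0r normrN normrX gtr0_norm // => ?; exists N.
have [Sx _] := Sw m; have x0 : 0 < w ^+ m by rewrite exprn_gt0.
set x := w ^+ m in Sx x0 wm.
(* Rounding [s / x] down leaves a remainder in [[0, x)], hence below [d]. *)
exists (x *~ Num.floor (s / x)); first exact: Sz.
have /andP[f1 f2] := floor_itv (s / x).
move: f1; rewrite ler_pdivlMr // => f1.
move: f2; rewrite ltr_pdivrMr // intrD mulrDl mul1r => f2.
rewrite -mulrzl ger0_norm ?subr_ge0 //; lra.
Qed.

End MoreDiscs.

(** * The bundle over the tube *)

Section TubeBundle.
Variable R : realType.
Local Notation C := R[i].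
Variables a b : R -> R.
Hypothesis a_cont : continuous (a : R^o -> R^o).
Hypothesis b_cont : continuous (b : R^o -> R^o).
Hypothesis a_gt0 : forall y, 0 < a y.

(** This is the set G of the gaps. Taking it to be the locus where [a] and [b] are locally constant
    makes the twist flat over the gaps by construction. *)
Definition flat_locus : set R := [set y | \forall t \near y, a t = a y /\ b t = b y].

Lemma open_flat_locus : open flat_locus.
Proof.
rewrite openE => y Gy; apply: filterS (nbhs_interior Gy) => t Gt.
have [at_ bt] : a t = a y /\ b t = b y by exact: nbhs_singleton Gt.
by apply: filterS Gt => u [-> ->].
Qed.

Definition pt2 (z1 z2 : C) : Cn R 2 := \row_(j < 2) if j == 0 then z1 else z2.

Lemma pt2E1 z1 z2 : pt2 z1 z2 0 0 = z1.
Proof. by rewrite mxE. Qed.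

Lemma pt2E2 z1 z2 : pt2 z1 z2 0 1 = z2.
Proof. by rewrite mxE. Qed.

Lemma pt2_eta (x : Cn R 2) : pt2 (x 0 0) (x 0 1) = x.
Proof.
apply/rowP => j; rewrite mxE; case: eqP => [->//|/eqP j0].
by congr (x 0 _); apply/val_inj; case: j j0 => [] [|[|]].
Qed.

(* [true] indexes the upper half-plane together with the gaps, where the fibre
   coordinate is untwisted, and [false] the lower half-plane. *)
Definition tube_dom (i : bool) : set (Cn R 2) :=
  if i then [set x | 0 < Im (x 0 1) \/ flat_locus (Im (x 0 0))]
  else [set x | Im (x 0 1) < 0].

Definition tube : set (Cn R 2) := \bigcup_i tube_dom i.

Definition tube_scale (i : bool) (x : Cn R 2) : R := if i then 1 else a (Im (x 0 0)).
Definition tube_shift (i : bool) (x : Cn R 2) : R := if i then 0 else b (Im (x 0 0)).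

Lemma Im_coord_continuous (j : 'I_2) : continuous (fun x : Cn R 2 => Im (x 0 j) : R^o).
Proof.
move=> x; apply: (@continuous_comp _ _ _ (fun x : Cn R 2 => x 0 j : C^o)
  (fun z : C^o => Im z : R^o)).
  exact: coord_continuous.
exact: Im_continuous.
Qed.

Lemma open_tube_dom i : open (tube_dom i).
Proof.
have oI j (A : set R) : open A -> open [set x : Cn R 2 | A (Im (x 0 j))].
  by move/continuousP : (@Im_coord_continuous j) => /(_ A).
case: i => /=.
  apply: openU; first exact: oI (@open_gt R 0).
  exact: oI open_flat_locus.
exact: oI (@open_lt R 0).
Qed.

Lemma tube_scale_continuous i x : tube_dom i x ->
  {for x, continuous (tube_scale i : _ -> R^o)}.
Proof.
move=> _; case: i => /=; first exact: cst_continuous.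
apply: (@continuous_comp _ _ _ (fun x : Cn R 2 => Im (x 0 0) : R^o) (a : R^o -> R^o)).
  exact: Im_coord_continuous.
exact: a_cont.
Qed.

Lemma tube_shift_continuous i x : tube_dom i x ->
  {for x, continuous (tube_shift i : _ -> R^o)}.
Proof.
move=> _; case: i => /=; first exact: cst_continuous.
apply: (@continuous_comp _ _ _ (fun x : Cn R 2 => Im (x 0 0) : R^o) (b : R^o -> R^o)).
  exact: Im_coord_continuous.
exact: b_cont.
Qed.

Lemma tube_scale_gt0 i x : 0 < tube_scale i x.
Proof. by case: i; [exact: ltr01|exact: a_gt0]. Qed.

Lemma near_flat (x : Cn R 2) : flat_locus (Im (x 0 0)) ->
  nbhs x [set y : Cn R 2 | a (Im (y 0 0)) = a (Im (x 0 0)) /\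
                           b (Im (y 0 0)) = b (Im (x 0 0))].
Proof. by move=> Gx; exact: (@Im_coord_continuous 0 x _ Gx). Qed.

(** The two pieces overlap only below gaps, where [a] and [b] are locally constant: the change of
    fibre coordinate is [u |-> a u + b] in one direction and its inverse in the other. *)
Lemma tube_flat i j x : tube_dom i x -> tube_dom j x -> exists c d : R,
  \forall y \near x, tube_scale j y = c * tube_scale i y /\
                     tube_shift j y = c * tube_shift i y + d.
Proof.
have triv k : exists c d : R, \forall y \near x, tube_scale k y = c * tube_scale k y /\
    tube_shift k y = c * tube_shift k y + d.
  exists 1, 0; apply: filterS (@filterT _ (nbhs x) _) => y _.
  by rewrite !mul1r addr0.
have [<- _ _|] := eqVneq i j; first exact: triv.
case: i j => -[] //= _.
- move=> [x0|Gx] x1; first by move: (lt_trans x0 x1); rewrite ltxx.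
  exists (a (Im (x 0 0))), (b (Im (x 0 0))).
  by apply: filterS (near_flat Gx) => y [-> ->]; rewrite mulr1 mulr0 add0r.
- move=> x1 [x0|Gx]; first by move: (lt_trans x0 x1); rewrite ltxx.
  exists (a (Im (x 0 0)))^-1, (- ((a (Im (x 0 0)))^-1 * b (Im (x 0 0)))).
  by apply: filterS (near_flat Gx) => y [-> ->]; rewrite mulVf ?gt_eqF // subrr.
Qed.

Variable g0 : R.
Hypothesis Gg0 : flat_locus g0.
Hypotheses (ag0 : a g0 = 1) (bg0 : b g0 = 0).

Lemma tube_base : tube (pt2 (g0 *i)%C 'i%C).
Proof. by exists true => //=; left; rewrite pt2E2 /= ltr01. Qed.

Definition tube_total : chartedSpace R :=
  total_space tube_dom tube_scale tube_shift tube_base.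

Local Notation tube_chart := (total_chart tube_dom tube_scale tube_shift tube_base).

Lemma tube_total_manifold : complex_manifold tube_total.
Proof.
exact: (total_manifold open_tube_dom erefl tube_scale_continuous tube_shift_continuous
  tube_scale_gt0 tube_flat tube_base).
Qed.

(** * Moves of zero length in the tube bundle *)

Definition pt3 (z1 z2 u : C) : tube_total :=
  to_sub (total_pt tube_base) (join (pt2 z1 z2) u).

Lemma join_pt2_line (z1 z2 u z1' z2' u' t : C) :
  join (pt2 z1 z2) u + t *: join (pt2 z1' z2') u' =
  join (pt2 (z1 + t * z1') (z2 + t * z2')) (u + t * u').
Proof.
apply/rowP => j; rewrite /join !mxE; case: (fintype.split j) => k; rewrite !mxE //.
by case: ifP.
Qed.

Lemma chart_inv_true z1 z2 u :
  chart_inv (tube_chart true) (join (pt2 z1 z2) u) = pt3 z1 z2 u.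
Proof.
rewrite /= /pt3 /unframe lsubmx_join last_coord_join /=.
by rewrite invr1 subr0 mul1r.
Qed.

Lemma chart_inv_false z1 z2 w : chart_inv (tube_chart false) (join (pt2 z1 z2) w) =
  pt3 z1 z2 (((a (Im z1))^-1)%:C%C * (w - (b (Im z1))%:C%C)).
Proof. by rewrite /= /pt3 /unframe lsubmx_join last_coord_join /= pt2E1. Qed.

Lemma tube_chart_codom i x w : tube_dom i x -> 0 < Im w ->
  chart_codom (tube_chart i) (join x w).
Proof.
move=> Dx w0; rewrite (total_chart_codom tube_shift erefl tube_scale_gt0).
by rewrite /chart_image /= lsubmx_join last_coord_join.
Qed.

(** A complex line of the base inside one piece lifts to the bundle with constant fibre coordinate
    in the chart of that piece. *)
Lemma close_line i z1 z2 z1' z2' u : 0 < Im u ->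
  (forall t, tube_dom i (pt2 (z1 + t * (z1' - z1)) (z2 + t * (z2' - z2)))) ->
  arb_close (chart_inv (tube_chart i) (join (pt2 z1 z2) u) : tube_total)
            (chart_inv (tube_chart i) (join (pt2 z1' z2') u)).
Proof.
move=> u0 hD.
rewrite (_ : join (pt2 z1' z2') u =
    join (pt2 z1 z2) u + join (pt2 (z1' - z1) (z2' - z2)) 0); last first.
  by rewrite -[X in _ + X]scale1r join_pt2_line !mul1r !subrKC addr0.
apply: (arb_close_line tube_total_manifold); first by exists i.
by move=> t; rewrite join_pt2_line mulr0 addr0; apply: tube_chart_codom.
Qed.

Lemma close_above z1 z1' z2 u : 0 < Im z2 -> 0 < Im u ->
  arb_close (pt3 z1 z2 u) (pt3 z1' z2 u).
Proof.
move=> z20 u0; rewrite -!chart_inv_true; apply: close_line => // t.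
by left; rewrite pt2E2 subrr mulr0 addr0.
Qed.

(** With [Im z1] in a gap, the line on which only [z2] varies lies entirely in the first piece, so
    [Im z2] may change sign without changing the untwisted coordinate. *)
Lemma close_across z1 z2 z2' u : flat_locus (Im z1) -> 0 < Im u ->
  arb_close (pt3 z1 z2 u) (pt3 z1 z2' u).
Proof.
move=> z10 u0; rewrite -!chart_inv_true; apply: close_line => // t.
by right; rewrite pt2E1 subrr mulr0 addr0.
Qed.

(** Below the real axis it is the twisted coordinate [w] that stays constant, so the untwisted one
    changes with [Im z1]; this is the source of the holonomy. *)
Lemma close_below z1 z1' z2 w : Im z2 < 0 -> 0 < Im w ->
  arb_close (pt3 z1 z2 (((a (Im z1))^-1)%:C%C * (w - (b (Im z1))%:C%C)))
            (pt3 z1' z2 (((a (Im z1'))^-1)%:C%C * (w - (b (Im z1'))%:C%C))).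
Proof.
move=> z20 w0; rewrite -!chart_inv_false; apply: close_line => // t.
by rewrite /= pt2E2 subrr mulr0 addr0.
Qed.

Definition fiber_pt (u : C) : tube_total := pt3 (g0 *i)%C 'i%C u.

Lemma close_to_fiber p : exists2 u, 0 < Im u & arb_close p (fiber_pt u).
Proof.
have [Ep u0] := set_typeP p.
have pE : p = pt3 (lsubmx (val p) 0 0) (lsubmx (val p) 0 1) (last_coord (val p)).
  by rewrite /pt3 pt2_eta join_lsubmx to_sub_val.
rewrite pE; move: Ep u0.
set z1 := lsubmx _ 0 0; set z2 := lsubmx _ 0 1; set u := last_coord _.
move=> Ep u0.
have i1 : 0 < Im ('i%C : C) by exact: ltr01.
move: Ep => [[] _ /=]; rewrite -/z1 -/z2.
- move=> [z20|Gz1]; exists u => //.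
    apply: (@arb_close_trans _ _ (pt3 (g0 *i)%C z2 u)); first exact: close_above.
    exact: close_across.
  apply: (@arb_close_trans _ _ (pt3 z1 'i%C u)); first exact: close_across.
  exact: close_above.
- move=> z20.
  (* This is the twisted coordinate of the point. Over [g0] it agrees with the untwisted one, as
     [a g0 = 1] and [b g0 = 0]. *)
  pose w := (a (Im z1))%:C%C * u + (b (Im z1))%:C%C.
  have w0 : 0 < Im w by rewrite /w ImD Im_realMl /= addr0 mulr_gt0.
  exists w => //.
  apply: (@arb_close_trans _ _ (pt3 (g0 *i)%C z2 w)); last exact: close_across.
  have := @close_below z1 (g0 *i)%C z2 w z20 w0.
  rewrite /= ag0 bg0 invr1 subr0 mul1r /w addrK mulrA -rmorphM mulVf ?gt_eqF //.
  by rewrite mul1r.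
Qed.

(* Cross the real axis downwards at [g] and upwards at [g0]. *)
Lemma close_holonomy g u : flat_locus g -> 0 < Im u ->
  arb_close (fiber_pt u) (fiber_pt ((a g)%:C%C * u + (b g)%:C%C)).
Proof.
move=> Gg u0; set w := _ + _.
have w0 : 0 < Im w by rewrite /w ImD Im_realMl /= addr0 mulr_gt0.
have i1 : 0 < Im ('i%C : C) by exact: ltr01.
have ni1 : Im (- 'i%C : C) < 0 by rewrite /= oppr_lt0.
apply: (@arb_close_trans _ _ (pt3 (g *i)%C 'i%C u)); first exact: close_above.
apply: (@arb_close_trans _ _ (pt3 (g *i)%C (- 'i%C) u)); first exact: close_across.
apply: (@arb_close_trans _ _ (pt3 (g0 *i)%C (- 'i%C) w)); last exact: close_across.
have := @close_below (g *i)%C (g0 *i)%C _ w ni1 w0.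
rewrite /= ag0 bg0 invr1 subr0 mul1r /w addrK mulrA -rmorphM mulVf ?gt_eqF //.
by rewrite mul1r.
Qed.

(** An affine disc inside the fibre suffices for a scaling close to 1. This corrects the error left
    when an exponent is approximated by elements of a dense subgroup. *)
Lemma close_fiber_small (u : C) e : 0 < Im u -> 0 < e ->
  exists2 d, 0 < d & forall s, `|s| < d ->
    linked (fiber_pt u) (fiber_pt ((expR s)%:C%C * u)) e.
Proof.
move=> u0 e0; have [r /andP[r0 r1] rE] := poincare_radius e0.
have nu0 : 0 < Re `|u|.
  by apply: lt_le_trans (ler_Im_norm u); rewrite normr_gt0 gt_eqF.
(* If [|expR s - 1|] is below this bound, then [|t (expR s - 1) u| < Im u] for [|t| < 1 / r], so the
   disc stays in the half-plane. *)
have k0 : 0 < r * Im u / Re `|u| by rewrite divr_gt0 // mulr_gt0.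
have := @continuous_expR R 0; rewrite /continuous_at expR0.
move=> /cvgrPdist_lt/(_ _ k0) /nbhs_ballP [d d0 hd].
exists d => // s sd; have {}hd : `|1 - expR s| < r * Im u / Re `|u|.
  by apply: hd; rewrite -ball_normE /= sub0r normrN.
rewrite /fiber_pt -!chart_inv_true -rE.
have -> : join (pt2 (g0 *i)%C 'i%C) ((expR s)%:C%C * u) =
    join (pt2 (g0 *i)%C 'i%C) u + join (pt2 0 0) ((expR s - 1)%:C%C * u).
  rewrite -[X in _ + X]scale1r join_pt2_line !mulr0 !addr0 mul1r rmorphB /= rmorph1.
  by congr join; ring.
apply: (linked_chart_disc tube_total_manifold); [by exists true|by rewrite r0|].
move=> t tr; rewrite join_pt2_line !mulr0 !addr0; apply: tube_chart_codom.
  by left; rewrite pt2E2 /= ltr01.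
set z := t * _; suff /(le_lt_trans (ler_Im_norm z)) : Re `|z| < Im u.
  by rewrite ImD ltr_norml => /andP[? _]; lra.
rewrite -ltr_norm_complex /z !normrM [`|u|]norm_complexE.
have -> : `|(expR s - 1)%:C%C| = `|expR s - 1|%:C%C.
  by rewrite normc_def /= expr0n addr0 sqrtr_sqr.
have h : r^-1 * (`|expR s - 1| * Re `|u|) < Im u.
  by rewrite ltr_pdivrMl // -ltr_pdivlMr // distrC.
apply: le_lt_trans (_ : (r^-1 * (`|expR s - 1| * Re `|u|))%:C%C < _);
  last by rewrite ltcR.
rewrite !rmorphM /=; apply: ler_wpM2r; last exact: ltW.
by rewrite mulr_ge0 // ler0c // ltW.
Qed.

Hypotheses (g1 g2 g3 : R).
Hypotheses (Gg1 : flat_locus g1) (ag1 : a g1 = expR 1) (bg1 : b g1 = 0).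
Hypotheses (Gg2 : flat_locus g2) (ag2 : a g2 = expR (Num.sqrt 2)) (bg2 : b g2 = 0).
Hypotheses (Gg3 : flat_locus g3) (ag3 : a g3 = 1) (bg3 : b g3 = 1).

Lemma close_scale s (u : C) : 0 < Im u ->
  arb_close (fiber_pt u) (fiber_pt ((expR s)%:C%C * u)).
Proof.
(* Quantifying over all [u] lets the moves be composed and inverted, so [S] is a subgroup. *)
pose S : set R := [set s | forall u : C, 0 < Im u ->
  arb_close (fiber_pt u) (fiber_pt ((expR s)%:C%C * u))].
have S1 : S 1.
  by move=> v v0; have := close_holonomy Gg1 v0; rewrite ag1 bg1 addr0.
have S2 : S (Num.sqrt 2).
  by move=> v v0; have := close_holonomy Gg2 v0; rewrite ag2 bg2 addr0.
have scale0 (x : R) (v : C) : 0 < Im v -> 0 < Im ((expR x)%:C%C * v).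
  by move=> v0; rewrite Im_realMl mulr_gt0 // expR_gt0.
have SB x y : S x -> S y -> S (x - y).
  move=> Sx Sy v v0; apply: (@arb_close_trans _ _ (fiber_pt ((expR (- y))%:C%C * v))).
    apply: arb_close_sym; have := Sy _ (scale0 (- y) _ v0).
    by rewrite mulrA -rmorphM -expRD subrr expR0 mul1r.
  by have := Sx _ (scale0 (- y) _ v0); rewrite mulrA -rmorphM -expRD.
move=> u0 e e0; have e20 : 0 < e / 4 by lra.
(* The route is [u], then [expR (s - s') u] by a short disc, then [expR s u] by holonomy; each leg
   costs at most [e / 4]. *)
have [d d0 hd] := close_fiber_small u0 e20.
have [s' Ss' ss'] := dense_subgroup S1 S2 SB s d0.
have [d' d'e l'] := Ss' _ (scale0 (s - s') _ u0) _ e20.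
exists (e / 4 + d'); first by lra.
apply: linked_trans (hd _ ss') _.
by move: l'; rewrite mulrA -rmorphM -expRD subrKC.
Qed.

Lemma close_translate (t : R) (u : C) : 0 < Im u ->
  arb_close (fiber_pt u) (fiber_pt (u + t%:C%C)).
Proof.
have pos (r : R) (v : C) : 0 < r -> 0 < Im v ->
    arb_close (fiber_pt v) (fiber_pt (v + r%:C%C)).
  (* Conjugating the unit translation by a scaling gives [expR (ln r) (w + 1) = v + r]. *)
  move=> r0 v0; pose w := (expR (- ln r))%:C%C * v.
  have w0 : 0 < Im w by rewrite Im_realMl mulr_gt0 // expR_gt0.
  have w10 : 0 < Im (w + 1) by rewrite ImD /= addr0.
  apply: (@arb_close_trans _ _ (fiber_pt w)); first exact: close_scale.
  apply: (@arb_close_trans _ _ (fiber_pt (w + 1))).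
    by have := close_holonomy Gg3 w0; rewrite ag3 bg3 mul1r.
  have := close_scale (ln r) w10.
  rewrite mulrDr mulr1 /w mulrA -rmorphM -expRD subrr expR0 mul1r.
  by rewrite lnK // posrE.
move=> u0; have [t0|t0|->] := ltgtP t 0; last first.
- by have := close_scale 0 u0; rewrite expR0 mul1r addr0.
- exact: pos.
(* For negative [t], the positive translation by [- t] leads from [u + t] back to [u]. *)
- have nt0 : 0 < - t by rewrite oppr_gt0.
  have ut0 : 0 < Im (u + t%:C%C) by rewrite ImD /= addr0.
  apply: arb_close_sym; have := pos _ _ nt0 ut0.
  by rewrite rmorphN /= addrK.
Qed.

Lemma tube_total_kobayashi (p q : tube_total) : kobayashi p q = 0%E.
Proof.
apply: kobayashi_eq0.
have [u u0 pu] := close_to_fiber p; have [w w0 qw] := close_to_fiber q.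
apply: arb_close_trans pu _; apply: arb_close_trans (arb_close_sym qw).
(* Scaling first matches the imaginary parts; a real translation then reaches [w]. *)
pose v := (expR (ln (Im w / Im u)))%:C%C * u.
have vE : Im v = Im w.
  by rewrite /v Im_realMl lnK ?posrE ?divr_gt0 // divfK // gt_eqF.
apply: (@arb_close_trans _ _ (fiber_pt v)); first exact: close_scale.
have -> : w = v + (Re w - Re v)%:C%C.
  apply/eqP; rewrite eq_complex; move: vE; case: (v) (w) => x y [x' y'] /= ->.
  by rewrite addr0 subrKC !eqxx.
by apply: close_translate; rewrite vE.
Qed.

End TubeBundle.

(** * The piecewise constant holonomy *)

Section StepFunctions.
Variable R : realType.

(** This is the truncation of [x] to [[0, 1]], written with absolute values so that continuity
    follows from that of the norm. *)
Definition step (x : R) : R := (`|x| - `|x - 1| + 1) / 2.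

Lemma step_le0 x : x <= 0 -> step x = 0.
Proof.
move=> x0; rewrite /step ler0_norm // ler0_norm; last by lra.
by rewrite (_ : - x - - (x - 1) + 1 = 0) ?mul0r //; ring.
Qed.

Lemma step_ge1 x : 1 <= x -> step x = 1.
Proof.
move=> x1; rewrite /step !ger0_norm; [|lra|lra].
by rewrite (_ : x - (x - 1) + 1 = 2) ?divff ?pnatr_eq0 //; ring.
Qed.

Let cst_cont (k x : R) : {for x, continuous (fun _ : R^o => k : R^o)}.
Proof. exact: cst_continuous. Qed.

Let sub_cont (k x : R) : {for x, continuous (fun t : R^o => t - k : R^o)}.
Proof. by apply: continuousB; [exact: cvg_id|exact: cst_cont]. Qed.

Lemma step_continuous : continuous (step : R^o -> R^o).
Proof.
move=> x; have c1 : {for x, continuous (fun t : R^o => `|t| : R^o)}.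
  exact: norm_continuous.
have c2 : {for x, continuous (fun t : R^o => `|t - 1| : R^o)}.
  apply: (@continuous_comp _ _ _ (fun t : R^o => t - 1 : R^o)
    (fun t : R^o => `|t| : R^o)).
    exact: sub_cont.
  exact: norm_continuous.
exact: (continuousM (continuousD (continuousB c1 c2) (@cst_cont 1 x))
  (@cst_cont 2^-1 x)).
Qed.

Lemma step_shift_continuous c : continuous (fun x : R^o => step (x - c) : R^o).
Proof.
move=> x; apply: (@continuous_comp _ _ _ (fun x : R^o => x - c : R^o)
  (step : R^o -> R^o)).
  exact: sub_cont.
exact: step_continuous.
Qed.

(** On [y <= 0], [[1, 2]], [[3, 4]] and [y >= 5] the values are 0, 1, [sqrt 2] and 0, while
    [translation] is 0, 0, 0 and 1. These are the four holonomies. *)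
Definition log_scale (y : R) : R :=
  step y + (Num.sqrt 2 - 1) * step (y - 2) - Num.sqrt 2 * step (y - 4).
Definition scale (y : R) : R := expR (log_scale y).
Definition translation (y : R) : R := step (y - 4).

Lemma scale_continuous : continuous (scale : R^o -> R^o).
Proof.
move=> y; apply: (@continuous_comp _ _ _ (log_scale : R^o -> R^o)
  (expR (R := R) : R^o -> R^o)).
  exact: (continuousB (continuousD (@step_continuous y)
      (continuousM (@cst_cont (Num.sqrt 2 - 1) y) (@step_shift_continuous 2 y)))
    (continuousM (@cst_cont (Num.sqrt 2) y) (@step_shift_continuous 4 y))).
exact: continuous_expR.
Qed.

Lemma scale_gt0 y : 0 < scale y.
Proof. exact: expR_gt0. Qed.

(** Radius [1 / 2] is what the plateaus [[1, 2]] and [[3, 4]] allow around their midpoints [3 / 2]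
    and [7 / 2]. *)
Lemma flat_plateau y c d :
  (forall t, `|t - y| < 1 / 2 -> log_scale t = c /\ translation t = d) ->
  [/\ flat_locus scale translation y, scale y = expR c & translation y = d].
Proof.
move=> h; have [hc hd] : log_scale y = c /\ translation y = d.
  by apply: h; rewrite subrr normr0; lra.
split=> //; last by rewrite /scale hc.
apply/nbhs_ballP; exists (1 / 2) => /=; first by lra.
move=> t; rewrite -ball_normE /= distrC => /h[tc td].
by rewrite /scale tc td hc hd.
Qed.

Lemma plateau0 : [/\ flat_locus scale translation (-1), scale (-1) = 1
  & translation (-1) = 0].
Proof.
rewrite -[X in scale _ = X]expR0.
apply: flat_plateau => t; rewrite ltr_norml /log_scale /translation => ?.
rewrite (@step_le0 t); last by lra.
rewrite (@step_le0 (t - 2)); last by lra.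
rewrite (@step_le0 (t - 4)); last by lra.
by split; ring.
Qed.

Lemma plateau1 : [/\ flat_locus scale translation (3 / 2), scale (3 / 2) = expR 1
  & translation (3 / 2) = 0].
Proof.
apply: flat_plateau => t; rewrite ltr_norml /log_scale /translation => ?.
rewrite (@step_ge1 t); last by lra.
rewrite (@step_le0 (t - 2)); last by lra.
rewrite (@step_le0 (t - 4)); last by lra.
by split; ring.
Qed.

Lemma plateau2 : [/\ flat_locus scale translation (7 / 2),
  scale (7 / 2) = expR (Num.sqrt 2) & translation (7 / 2) = 0].
Proof.
apply: flat_plateau => t; rewrite ltr_norml /log_scale /translation => ?.
rewrite (@step_ge1 t); last by lra.
rewrite (@step_ge1 (t - 2)); last by lra.
rewrite (@step_le0 (t - 4)); last by lra.
by split; ring.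
Qed.

Lemma plateau3 : [/\ flat_locus scale translation 6, scale 6 = 1 & translation 6 = 1].
Proof.
rewrite -[X in scale 6 = X]expR0.
apply: flat_plateau => t; rewrite ltr_norml /log_scale /translation => ?.
rewrite (@step_ge1 t); last by lra.
rewrite (@step_ge1 (t - 2)); last by lra.
rewrite (@step_ge1 (t - 4)); last by lra.
by split; ring.
Qed.

End StepFunctions.

Theorem theorem6p1 (R : realType) :
  exists (Y B : chartedSpace R) (rho : Y -> B),
    [/\ complex_manifold Y,
        complex_manifold B,
        [set: Y] !=set0,
        disc_bundle rho &
        forall p q : Y, kobayashi p q = 0%E].
Proof.
have ac := @scale_continuous R; have bc := @step_shift_continuous R 4.
have a0 := @scale_gt0 R.
have [G0 ag0 bg0] := plateau0 R; have [G1 ag1 bg1] := plateau1 R.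
have [G2 ag2 bg2] := plateau2 R; have [G3 ag3 bg3] := plateau3 R.
exists (tube_total (@scale R) (@translation R) (-1)).
exists (base_space (tube_base (@scale R) (@translation R) (-1))).
exists (@bundle_proj R 2 _ bool _ _ _ _ (tube_base (@scale R) (@translation R) (-1))).
split.
- exact: tube_total_manifold.
- exact: (base_manifold (@open_tube_dom R _ _)).
- by exists (total_pt (tube_base (@scale R) (@translation R) (-1))).
- exact: (total_disc_bundle (@open_tube_dom R _ _) erefl (tube_scale_continuous ac)
    (tube_shift_continuous bc) (tube_scale_gt0 a0) (tube_flat a0)).
- exact: (tube_total_kobayashi ac bc a0 G0 ag0 bg0 G1 ag1 bg1 G2 ag2 bg2 G3 ag3 bg3).
Qed.
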